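(* There exists an absolute constant $c_0>0$ such that with high probability, for every integer $k$ with $0\le k\le k_0:=\sqrt{\frac{c_0 n}{\log n}}$, we have $\mathcal L_k\subseteq C_{\tau_{\mathrm{end}}}$.
   Context: Let $n\ge 1$ and $\mathcal B=\{0,1\}^n$ with the coordinatewise partial order; $\mathbf 0=(0,\dots,0)$, $\mathbf 1=(1,\dots,1)$, $|x|$ denotes the number of ones of $x$, and $\mathcal L_k=\{x\in\mathcal B:|x|=k\}$ is the $k$th level, so $|\mathcal L_k|=\binom nk$. A random decreasing walk from $\mathbf 1$ is a maximal chain $\mathbf 1=x_n>x_{n-1}>\dots>x_0=\mathbf 0$ with $x_i\in\mathcal L_i$, chosen uniformly among all $n!$ such chains (equivalently, each step turns a uniformly random remaining $1$ into $0$). The DLA process on $\mathcal B$: $C_0=\{\mathbf 0\}$; for $t\ge1$, let $\rho_t$ be a random decreasing walk from $\mathbf 1$, independent of everything before; let $v$ be the last vertex of the longest initial segment of $\rho_t$ that is disjoint from $C_{t-1}$, and set $C_t=C_{t-1}\cup\{v\}$. The process terminates at the first time $\tau_{\mathrm{end}}$ with $\mathbf 1\in C_{\tau_{\mathrm{end}}}$ (for $t>\tau_{\mathrm{end}}$ put $C_t=C_{\tau_{\mathrm{end}}}$). A vertex is occupied at time $t$ if it lies in $C_t$. ''With high probability'' (w.h.p.) means with probability tending to $1$ as $n\to\infty$; $\log$ is the natural logarithm. *)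

(* Defs.v *)
From Stdlib Require Import Reals.
From mathcomp Require Import all_boot all_fingroup.
Set Implicit Arguments. Unset Strict Implicit. Unset Printing Implicit Defensive.

(* Vertices of B = {0,1}^n are encoded as subsets of 'I_n (the coordinates
   equal to 1); |x| = #|x|, 0 = set0, 1 = setT, level L_k = sets of size k. *)

(* A maximal decreasing chain from 1 to 0 is encoded by a permutation s of
   'I_n: the j-th step turns coordinate s j into 0.  This is a bijection
   between 'S_n and the n! maximal chains, so the uniform walk is the uniform
   permutation.  walk_vertex s j = x_{n-j}, the vertex after j steps. *)
Definition walk_vertex n (s : {perm 'I_n}) (j : nat) : {set 'I_n} :=
  [set i | i \notin [set s m | m : 'I_n & (m < j)%N]].

Definition first_hit n (C : {set {set 'I_n}}) (s : {perm 'I_n}) : nat :=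
  find (fun j => walk_vertex s j \in C) (iota 0 n.+1).

(* One DLA step: add the last vertex before the walk first hits C.
   If 1 is already occupied the process has terminated and C is unchanged. *)
Definition dla_step n (C : {set {set 'I_n}}) (s : {perm 'I_n}) : {set {set 'I_n}} :=
  if setT \in C then C else C :|: [set walk_vertex s (first_hit C s).-1].

Definition dla_cluster n (w : seq {perm 'I_n}) : {set {set 'I_n}} :=
  foldl (@dla_step n) [set set0] w.

(* Each step before termination adds a new vertex, so tau_end <= 2^n - 1;
   hence with 2^n independent walks the final cluster is C_{tau_end}. *)
Definition nwalks (n : nat) : nat := 2 ^ n.

Definition sample_space (n : nat) := {ffun 'I_(nwalks n) -> {perm 'I_n}}.

Definition dla_final n (w : sample_space n) : {set {set 'I_n}} :=
  dla_cluster [seq w i | i <- enum 'I_(nwalks n)].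

Definition Rle_bool (a b : R) : bool := if Rle_dec a b then true else false.

Definition low_levels_filled n (k0 : R) (w : sample_space n) : bool :=
  [forall x : {set 'I_n}, Rle_bool (INR #|x|) k0 ==> (x \in dla_final w)].

Definition prob_low_levels_filled (n : nat) (k0 : R) : R :=
  Rdiv (INR #|[set w : sample_space n | low_levels_filled k0 w]|)
       (INR #|[set: sample_space n]|).

Definition k0_of (c0 : R) (n : nat) : R := sqrt (Rdiv (Rmult c0 (INR n)) (ln (INR n))).

(* Main.v *)
Require Import Defs.
From Stdlib Require Import Reals.
From Stdlib Require Lra.
From mathcomp Require Import all_boot all_fingroup.
From mathcomp Require Import all_order all_algebra.
From mathcomp Require Import reals Rstruct sequences exp.
From mathcomp Require Import ring lra zify.
Set Implicit Arguments. Unset Strict Implicit. Unset Printing Implicit Defensive.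
Import Order.TTheory GRing.Theory Num.Theory.

(* Let k be the integer part of k_0, l ~ log_2 n and T_j = 12 k l C(n, j). By
   induction on j <= k, level j is full at time T_j. For a vertex v of level j,
   a walk conditioned to pass through v is stopped above v with probability at
   most the sum of 1/C(n - j, |u| - j) over the occupied u strictly above v.
   Every occupied vertex lies on one of the walks, so this sum is dominated by
   a sum of T_j independent variables, each at most 2/(n - j), of total mean
   O(T_j / C(n, j + 1)) = O(k^2 l / n); by Chernoff's bound it exceeds 1/2 with
   probability exp(-Omega(n)), which beats the n^k vertices v. Hence once level
   j - 1 is full each walk fills v with probability at least 1/(2 C(n, j)), and
   v stays empty between T_(j-1) and T_j with probability at most 2^(-3 k l).
   The high levels are controlled by a first moment: a new vertex at level i + 1
   requires a walk through an occupied vertex of level i, so the expected number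
   of occupied vertices at level i + 1 is at most T / C(n, i) times that at
   level i, and level 2k + 5 is empty at time T_k; in particular the process
   has not stopped. *)

(** * Expectation over a sequence of independent uniform steps *)

Section Expectation.
Local Open Scope ring_scope.
Variables (R : realFieldType) (S : finType).
Hypothesis S_gt0 : (0 < #|S|)%N.

Definition avg (f : S -> R) : R := (\sum_s f s) / #|S|%:R.

(** The last step is averaged first, with the earlier steps [w] held fixed, so that one unfolding is
    conditioning on the history of the process. *)
Fixpoint expect (m : nat) (f : seq S -> R) : R :=
  if m is m'.+1 then expect m' (fun w => avg (fun s => f (rcons w s)))
  else f [::].

Lemma cardS_neq0 : #|S|%:R != 0 :> R.
Proof. by rewrite pnatr_eq0 -lt0n. Qed.

Lemma eq_avg f g : f =1 g -> avg f = avg g.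
Proof. by move=> fg; congr (_ / _); apply: eq_bigr => s _; exact: fg. Qed.

Lemma le_avg f g : (forall s, f s <= g s) -> avg f <= avg g.
Proof.
by move=> fg; rewrite ler_pM2r ?invr_gt0 ?ltr0n //; apply: ler_sum => s _.
Qed.

Lemma avg_const c : avg (fun=> c) = c.
Proof.
by rewrite /avg sumr_const -(mulr_natr c) mulfK ?cardS_neq0.
Qed.

Lemma avgD f g : avg (fun s => f s + g s) = avg f + avg g.
Proof. by rewrite /avg big_split mulrDl. Qed.

Lemma avgZ c f : avg (fun s => c * f s) = c * avg f.
Proof. by rewrite /avg -mulr_sumr mulrA. Qed.

Lemma avg_sum (I : finType) (P : pred I) (F : I -> S -> R) :
  avg (fun s => \sum_(i | P i) F i s) = \sum_(i | P i) avg (F i).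
Proof. by rewrite /avg exchange_big /= mulr_suml. Qed.

Lemma le_expect m f g : (forall w, size w = m -> f w <= g w) ->
  expect m f <= expect m g.
Proof.
elim: m f g => [|m IH] f g fg /=; first exact: fg.
apply: IH => w wm; apply: le_avg => s; apply: fg; by rewrite size_rcons wm.
Qed.

Lemma eq_expect m f g : (forall w, size w = m -> f w = g w) ->
  expect m f = expect m g.
Proof.
by move=> fg; apply/le_anti/andP; split; apply: le_expect => w /fg ->.
Qed.

Lemma expect_const m c : expect m (fun=> c) = c.
Proof.
elim: m => //= m IH; rewrite -[RHS]IH; apply: eq_expect => w _.
exact: avg_const.
Qed.

Lemma expectD m f g : expect m (fun w => f w + g w) = expect m f + expect m g.
Proof.
elim: m f g => //= m IH f g; rewrite -IH; apply: eq_expect => w _.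
exact: avgD.
Qed.

Lemma expectZ m c f : expect m (fun w => c * f w) = c * expect m f.
Proof.
elim: m f => //= m IH f; rewrite -IH; apply: eq_expect => w _; exact: avgZ.
Qed.

Lemma expect_sum m (I : finType) (P : pred I) (F : I -> seq S -> R) :
  expect m (fun w => \sum_(i | P i) F i w) = \sum_(i | P i) expect m (F i).
Proof.
elim: m F => //= m IH F; rewrite -IH; apply: eq_expect => w _; exact: avg_sum.
Qed.

Lemma expect_prod m (h : S -> R) :
  expect m (fun w => \prod_(s <- w) h s) = avg h ^+ m.
Proof.
elim: m => [|m IH] /=; first by rewrite big_nil expr0.
rewrite exprS -IH -expectZ; apply: eq_expect => w _.
rewrite mulrC -avgZ; apply: eq_avg => s.
by rewrite -cats1 big_cat big_seq1.
Qed.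

(** An event decided by the first [t] walks keeps its probability when further walks are added;
    events tied to different times can thus be combined on one sample space. *)
Lemma expect_take m t f : (t <= m)%N ->
  expect m (fun w => f (take t w)) = expect t f.
Proof.
elim: m => [|m IH]; first by rewrite leqn0 => /eqP ->.
rewrite leq_eqVlt => /predU1P [->|]; first by apply: eq_expect => w <-; rewrite take_size.
rewrite ltnS => tm; rewrite -IH //=; apply: eq_expect => w wm.
rewrite -[RHS]avg_const; apply: eq_avg => s.
by rewrite -cats1 take_cat wm; move: tm; case: ltngtP => // ->; rewrite subnn take0 cats0 -wm take_size.
Qed.

Lemma expect_cons m f :
  expect m.+1 f = avg (fun s => expect m (fun w => f (s :: w))).
Proof.
by elim: m f => // m IH f; exact: (IH (fun w => avg (fun s => f (rcons w s)))).
Qed.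

(** The passage from counting in the sample space to [expect]: a function on ['I_m] is read as the
    tuple of its values, and tuples are split at the head. *)
Lemma expect_ffun m (f : seq S -> R) :
  \sum_(w : {ffun 'I_m -> S}) f [seq w i | i <- enum 'I_m]
  = #|S|%:R ^+ m * expect m f.
Proof.
rewrite (reindex (fun t : m.-tuple S => [ffun i => tnth t i])); last first.
  exists (fun w : {ffun 'I_m -> S} => [tuple w i | i < m]) => [t _|w _].
    by apply: eq_from_tnth => i; rewrite tnth_mktuple ffunE.
  by apply/ffunP => i; rewrite ffunE tnth_mktuple.
under eq_bigr => t _.
  under eq_map => i do rewrite ffunE.
  rewrite map_tnth_enum.
  over.
elim: m f => [|m IH] f.
  rewrite expr0 mul1r (big_pred1 [tuple]) // => t; apply/esym/eqP; exact: tuple0.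
rewrite expect_cons (reindex (fun p : S * m.-tuple S => [tuple of p.1 :: p.2])) /=; last first.
  exists (fun t : m.+1.-tuple S => (thead t, [tuple of behead t])) => [[s t] _|t _].
    by congr pair => //; apply: val_inj.
  by rewrite -tuple_eta.
rewrite -(pair_big predT predT (fun s t => f (s :: tval t))) /=.
rewrite /avg exprS.
under eq_bigr do rewrite (IH (fun w => f (_ :: w))).
by rewrite -mulr_sumr; field; exact: cardS_neq0.
Qed.

(* The cumulative event is tested at every time of the window, so that one
   more factor [q] is gained at each step. *)
Lemma expect_stay (X : Type) (step : X -> S -> X) (x0 : X) (G : pred X) (q : R) :
  0 <= q -> (forall x, G x -> avg (fun s => (G (step x s))%:R) <= q) ->
  forall a d, expect (a + d)
    (fun w => (all (fun t => G (foldl step x0 (take t w))) (iota a d.+1))%:R)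
    <= q ^+ d.
Proof.
move=> q0 Gq a; elim=> [|d IH].
  by rewrite expr0 -[leRHS](expect_const (a + 0)); apply: le_expect => w _; case: (all _ _).
rewrite addnS exprS.
  apply: le_trans (ler_wpM2l q0 IH); rewrite -expectZ.
  apply: (@le_expect (a + d)) => w wm.
  have E s : all (fun t => G (foldl step x0 (take t (rcons w s)))) (iota a d.+2) =
    all (fun t => G (foldl step x0 (take t w))) (iota a d.+1) &&
    G (step (foldl step x0 w) s).
    rewrite -[d.+2]addn1 iotaD all_cat -cats1; congr andb.
      apply: eq_in_all => t; rewrite mem_iota => /andP[_].
      rewrite addnS ltnS -wm => tw; rewrite take_cat.
      by move: tw; case: ltngtP => // ->; rewrite subnn take0 cats0 take_size.
    by rewrite /= andbT addnS take_oversize ?foldl_cat // size_cat wm addn1.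
  under eq_avg do rewrite E.
  case: (boolP (all _ _)) => [/allP H|_] /=; last by rewrite avg_const mulr0.
  rewrite mulr1; apply: Gq; rewrite -(take_size w); apply: H.
  by rewrite mem_iota wm leq_addr addnS ltnS /=.
Qed.

End Expectation.

(** * Random maximal chains *)

Section Walks.
Variable n : nat.
Implicit Types (s : {perm 'I_n}) (u v : {set 'I_n}).

Lemma in_walk_vertex s j i : (i \in walk_vertex s j) = (j <= (s^-1)%g i).
Proof.
rewrite inE; apply/negP/idP => [H|ji].
  rewrite leqNgt; apply/negP => ij; apply: H; apply/imsetP.
  by exists ((s^-1)%g i); rewrite ?inE ?permKV.
case/imsetP => m; rewrite inE => mj im.
by move: ji; rewrite im permK leqNgt mj.
Qed.

Lemma walk_vertex0 s : walk_vertex s 0 = setT.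
Proof. by apply/setP => i; rewrite in_walk_vertex inE. Qed.

Lemma walk_vertexn s : walk_vertex s n = set0.
Proof. by apply/setP => i; rewrite in_walk_vertex inE leqNgt ltn_ord. Qed.

Lemma card_walk_vertex s j : #|walk_vertex s j| = n - j.
Proof.
have -> : walk_vertex s j = s @: [set i : 'I_n | j <= i].
  by apply/setP => i; rewrite in_walk_vertex -[in RHS](permKV s i) mem_imset ?inE //; exact: perm_inj.
rewrite card_imset; last exact: perm_inj.
have /= := cardsC [set i : 'I_n | i < j]; rewrite card_ord.
have -> : ~: [set i : 'I_n | i < j] = [set i : 'I_n | j <= i].
  by apply/setP => i; rewrite !inE -leqNgt.
suff -> : #|[set i : 'I_n | i < j]| = minn j n.
  by move=> /(congr1 (subn^~ (minn j n))); rewrite addKn => ->; lia.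
have [jn|nj] := leqP j n.
  by rewrite -sum1dep_card (big_ord_narrow jn) big_const_ord iter_addn_0 mul1n.
rewrite -[RHS](card_ord n); apply: eq_card => i; rewrite !inE.
by apply: ltn_trans nj.
Qed.

Lemma subset_walk_vertex s j k : j <= k -> walk_vertex s k \subset walk_vertex s j.
Proof. by move=> jk; apply/subsetP => i; rewrite !in_walk_vertex; apply: leq_trans. Qed.

Definition on_walk s u := walk_vertex s (n - #|u|) == u.

Lemma card_leqn u : #|u| <= n.
Proof. by rewrite -[leqRHS](card_ord n) max_card. Qed.

Lemma on_walk_vertex s j : j <= n -> on_walk s (walk_vertex s j).
Proof. by move=> jn; rewrite /on_walk card_walk_vertex subKn. Qed.

Lemma walk_vertexM s p j : walk_vertex (s * p)%g j = p @: walk_vertex s j.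
Proof.
apply/setP => i; rewrite in_walk_vertex -[in RHS](permKV p i) mem_imset; last exact: perm_inj.
by rewrite in_walk_vertex invMg permM.
Qed.

Lemma on_walkM s p u : on_walk (s * p)%g (p @: u) = on_walk s u.
Proof.
rewrite /on_walk walk_vertexM card_imset; last exact: perm_inj.
by apply/eqP/eqP => [|->//]; apply: imset_inj; exact: perm_inj.
Qed.

Lemma walk_through u v : v \subset u -> exists s, on_walk s u && on_walk s v.
Proof.
(* The order in which the coordinates are turned off: first those outside [u], then those of [u]
   outside [v], then those of [v]. *)
move=> vu; pose l := enum (~: u) ++ enum (u :\: v) ++ enum v.
have cu : #|~: u| = n - #|u| by rewrite cardsCs setCK card_ord.
have cuv : #|u :\: v| = #|u| - #|v| by rewrite cardsD (setIidPr vu).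
have lvu := subset_leq_card vu; have lun := card_leqn u.
have sl : size l = n by rewrite !size_cat -!cardE cu cuv; lia.
have ul : uniq l.
  rewrite !cat_uniq !enum_uniq /= andbT; apply/andP; split.
    apply/hasPn => i; rewrite mem_cat !mem_enum !inE.
    case/orP => [/andP[_ ->]//|iv]; by rewrite (subsetP vu).
  by apply/hasPn => i; rewrite !mem_enum !inE => ->.
have f_inj : injective (fun m : 'I_n => nth m l m).
  move=> a b /eqP; rewrite (set_nth_default b) ?sl // nth_uniq ?sl // => /eqP.
  exact: val_inj.
pose s := perm f_inj.
have Hs j : j <= n -> walk_vertex s j = [set i | i \notin take j l].
  move=> jn; apply/setP => i; rewrite !inE; congr negb.
  apply/imsetP/idP => [[m]|it].
    rewrite inE => mj ->; rewrite permE -(@nth_take j) //.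
    by apply: mem_nth; rewrite size_take sl; case: ifP.
  have := it; rewrite -index_mem => ij.
  have it' : index i (take j l) < j.
    by apply: leq_trans ij _; rewrite size_take_min geq_minl.
  have itn := leq_trans it' jn.
  exists (Ordinal itn); first by rewrite inE.
  by rewrite permE /= -(@nth_take j) // nth_index.
exists s; apply/andP; split; apply/eqP; rewrite Hs ?leq_subr //.
  rewrite /l take_size_cat; last by rewrite -cardE cu.
  by apply/setP => i; rewrite inE mem_enum inE negbK.
rewrite /l catA take_size_cat; last by rewrite size_cat -!cardE cu cuv; lia.
apply/setP => i; rewrite inE mem_cat !mem_enum !inE.
case: (boolP (i \in v)) => [/(subsetP vu) ->//|]; by case: (i \in u).
Qed.

Definition flags i j :=
  [set p : {set 'I_n} * {set 'I_n} | [&& #|p.1| == i, p.2 \subset p.1 & #|p.2| == j]].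

Lemma card_flags i j : #|flags i j| = 'C(n, i) * 'C(i, j).
Proof.
rewrite -[in 'C(n, i)](card_ord n) -(card_draws _ i) -sum_nat_const /flags.
rewrite -sum1dep_card -(pair_big_dep (fun u => #|u| == i) (fun u v => (v \subset u) && (#|v| == j)) (fun _ _ => 1)) /=.
  apply: eq_big => [u|u /eqP ui]; first by rewrite inE.
  by rewrite sum1dep_card cards_draws ui.
Qed.

(* The symmetric group acts transitively on flags, and every walk passes
   through exactly one flag of given levels. *)
Lemma card_on_flag u v : v \subset u ->
  #|[set s | on_walk s u && on_walk s v]| * ('C(n, #|u|) * 'C(#|u|, #|v|)) = n`!.
Proof.
move=> vu; set a := #|_|.
have same u' v' : v' \subset u' -> #|u'| = #|u| -> #|v'| = #|v| ->
    #|[set s | on_walk s u' && on_walk s v']| = a.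
  move=> vu' cu cv.
  have [s /andP[/eqP su /eqP sv]] := walk_through vu.
  have [s' /andP[/eqP su' /eqP sv']] := walk_through vu'.
  (* Right multiplication by [p] relabels coordinates and carries the walks through [u] and [v]
     bijectively to those through [u'] and [v']. *)
  pose p := (s^-1 * s')%g.
  have pu : p @: u = u'.
    by rewrite -su -walk_vertexM /p mulKVg -cu su'.
  have pv : p @: v = v'.
    by rewrite -sv -walk_vertexM /p mulKVg -cv sv'.
  rewrite /a -[RHS](card_imset _ (mulIg p)) -pu -pv.
  apply: eq_card => t; rewrite -[t](mulgKV p).
  by rewrite [RHS](mem_imset _ _ (mulIg p)) !inE !on_walkM.
rewrite -card_flags mulnC -sum_nat_const.
rewrite (eq_bigr (fun p => \sum_(s | on_walk s p.1 && on_walk s p.2) 1)); last first.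
  case=> u' v'; rewrite inE /= => /and3P[/eqP cu vu' /eqP cv].
  by rewrite sum1dep_card same.
rewrite (exchange_big_dep predT) //= (eq_bigr (fun=> 1)).
  by rewrite sum1_card card_Sn.
move=> s _; apply: (@big_pred1 _ _ _ _ (walk_vertex s (n - #|u|), walk_vertex s (n - #|v|))).
case=> u' v' /=; rewrite inE /= /on_walk xpair_eqE.
have lu := card_leqn u; have lv := card_leqn v.
apply/idP/idP.
  by case/andP => /and3P[/eqP -> _ /eqP ->] /andP[/eqP -> /eqP ->]; rewrite !eqxx.
case/andP => /eqP -> /eqP ->; rewrite !card_walk_vertex !subKn // !eqxx /= !andbT.
by apply: subset_walk_vertex; rewrite leq_sub2l // subset_leq_card.
Qed.

End Walks.

(** * Probability that a uniform walk passes through given vertices *)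

Section WalkProbability.
Local Open Scope ring_scope.
Variables (R : realFieldType) (n : nat).
Implicit Types (s : {perm 'I_n}) (u v : {set 'I_n}).

Lemma card_perm_gt0 : (0 < #|{perm 'I_n}|)%N.
Proof. by rewrite card_Sn fact_gt0. Qed.

Lemma avg_on_flag u v : v \subset u ->
  avg (fun s => (on_walk s u && on_walk s v)%:R : R) =
  ('C(n, #|u|)%:R * 'C(#|u|, #|v|)%:R)^-1.
Proof.
move=> vu; rewrite /avg -natr_sum -big_mkcond sum1dep_card.
have H := card_on_flag vu.
rewrite card_Sn -H !natrM.
have b1 : ('C(n, #|u|)%:R != 0 :> R) by rewrite pnatr_eq0 -lt0n bin_gt0 card_leqn.
have b2 : ('C(#|u|, #|v|)%:R != 0 :> R) by rewrite pnatr_eq0 -lt0n bin_gt0 subset_leq_card.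
have b3 : (#|[set s | on_walk s u && on_walk s v]|%:R != 0 :> R).
  by rewrite pnatr_eq0; apply/eqP => E; move: H (fact_gt0 n); rewrite E mul0n => <-.
by field; rewrite b1 b2 b3.
Qed.

Lemma avg_on_walk u : avg (fun s => (on_walk s u)%:R : R) = 'C(n, #|u|)%:R^-1.
Proof.
have := avg_on_flag (subxx u); rewrite binn mulr1 => <-.
by apply: eq_avg => s; rewrite andbb.
Qed.

Lemma card_supersets v i : (#|v| <= i <= n)%N ->
  #|[set u : {set 'I_n} | (v \subset u) && (#|u| == i)]| = 'C(n - #|v|, i - #|v|).
Proof.
case/andP => vi lin.
have cv : #|~: v| = (n - #|v|)%N by rewrite cardsCs setCK card_ord.
have lv := card_leqn v.
rewrite -bin_sub; last by rewrite leq_sub2r.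
have -> : (n - #|v| - (i - #|v|) = n - i)%N by lia.
rewrite -cv -cards_draws -(card_imset _ (inv_inj (@setCK 'I_n))).
apply: eq_card => u; apply/imsetP/idP => [[u' + ->]|].
  rewrite !inE => /andP[vu /eqP ui]; rewrite setCS vu /=.
  by rewrite cardsCs setCK card_ord ui.
rewrite !inE => /andP[uv /eqP cu]; exists (~: u); last by rewrite setCK.
rewrite inE -setCS setCK uv cardsCs setCK card_ord cu subKn //=.
Qed.
End WalkProbability.

(** * The cluster and its one-step transitions *)

(** Clearing factorials turns both sides into [n!]. The identity factors the probability of a flag
    into that of its lower vertex and the conditional one, called [weight] below. *)
Lemma bin_mul_bin n i j : j <= i <= n ->
  'C(n, i) * 'C(i, j) = 'C(n, j) * 'C(n - j, i - j).
Proof.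
case/andP => ji lin.
have jn := leq_trans ji lin.
have f_gt0 : 0 < j`! * (i - j)`! * (n - i)`! by rewrite !muln_gt0 !fact_gt0.
apply/eqP; rewrite -(eqn_pmul2r f_gt0); apply/eqP.
have E1 := bin_fact lin; have E2 := bin_fact ji; have E3 := bin_fact jn.
have E4 := bin_fact (leq_sub2r j lin).
rewrite (_ : n - j - (i - j) = n - i) in E4; last by lia.
transitivity n`!.
  by rewrite -E1 -[in RHS]E2; ring.
by rewrite -E3 -[in LHS]E4; ring.
Qed.

Section Cluster.
Variable n : nat.
Implicit Types (s : {perm 'I_n}) (u v : {set 'I_n}) (C : {set {set 'I_n}}).
Implicit Types w : seq {perm 'I_n}.

(** The index of the first hit lies between 1 and [n], since 1 is free and 0 is occupied, so its
    predecessor [h] is a genuine step and no truncated [.-1] remains. *)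
Lemma dla_stepP C s : set0 \in C -> setT \notin C ->
  exists h, [/\ h < n, walk_vertex s h.+1 \in C,
    forall k, k <= h -> walk_vertex s k \notin C
    & dla_step C s = walk_vertex s h |: C].
Proof.
move=> C0 CT; rewrite /dla_step (negPf CT).
have hC : has (fun j => walk_vertex s j \in C) (iota 0 n.+1).
  by apply/hasP; exists n; rewrite ?mem_iota ?walk_vertexn //= add0n.
have := hC; rewrite has_find size_iota -/(first_hit C s) => hn.
have := nth_find 0 hC; rewrite -/(first_hit C s) nth_iota // add0n => hh.
have hlt k : k < first_hit C s -> walk_vertex s k \notin C.
  move=> kh; have := before_find 0 kh.
  by rewrite nth_iota ?add0n => [->//|]; exact: ltn_trans hn.
case E : (first_hit C s) hn hh hlt => [|h] hn hh hlt.
  by move: hh; rewrite walk_vertex0 (negPf CT).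
by exists h; split=> //; rewrite setUC.
Qed.

Lemma dla_step_sub C s : C \subset dla_step C s.
Proof. by rewrite /dla_step; case: ifP => // _; exact: subsetUl. Qed.

Lemma dla_clusterS w s : dla_cluster (rcons w s) = dla_step (dla_cluster w) s.
Proof. by rewrite /dla_cluster foldl_rcons. Qed.

Lemma dla_cluster_cat w w' : dla_cluster w \subset dla_cluster (w ++ w').
Proof.
elim/last_ind: w' => [|w' s IH]; first by rewrite cats0.
by rewrite -rcons_cat dla_clusterS (subset_trans IH) // dla_step_sub.
Qed.

Lemma dla_cluster_take w a b : a <= b ->
  dla_cluster (take a w) \subset dla_cluster (take b w).
Proof. by move=> ab; rewrite -(take_takel w ab) -{2}(cat_take_drop a (take b w)) dla_cluster_cat. Qed.

Lemma set0_in_cluster w : set0 \in dla_cluster w.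
Proof. by apply: (subsetP (dla_cluster_cat [::] w)); rewrite inE. Qed.

Lemma dla_step_on_walk C s u : set0 \in C ->
  u \in dla_step C s -> (u \in C) || on_walk s u.
Proof.
move=> C0; have [CT|/(dla_stepP s C0)[h [hn _ _ ->]]] := boolP (setT \in C).
  by rewrite /dla_step CT => ->.
rewrite !inE => /predU1P[->|->//]; by rewrite on_walk_vertex ?orbT // ltnW.
Qed.

(** Each added vertex has an occupied vertex just below it, so the occupied levels have no gaps. One
    empty level thus rules out all higher ones, the vertex 1 included. *)
Lemma cluster_level_below w i u : u \in dla_cluster w -> i <= #|u| ->
  exists2 u', u' \in dla_cluster w & #|u'| = i.
Proof.
elim/last_ind: w u => [|w s IH] u.
  by rewrite inE => /eqP ->; rewrite cards0 leqn0 => /eqP ->; exists set0; rewrite ?inE ?cards0.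
rewrite dla_clusterS => uC iu.
have sub := subsetP (dla_step_sub (dla_cluster w) s).
have [uw|uw] := boolP (u \in dla_cluster w).
  by have [u' u'w <-] := IH u uw iu; exists u' => //; exact: sub.
have C0 := set0_in_cluster w.
have [CT|CT] := boolP (setT \in dla_cluster w).
  by move: uC uw; rewrite /dla_step CT => ->.
move: (uC); have [h [hn hC _ E]] := dla_stepP s C0 CT.
rewrite E in_setU1 (negPf uw) orbF => /eqP uE.
move: iu; rewrite leq_eqVlt => /predU1P[->|iu]; first by exists u; rewrite // -E.
have [|u' u'w <-] := IH _ hC; last by exists u' => //; rewrite -E sub.
by move: iu; rewrite uE !card_walk_vertex; lia.
Qed.

Definition nlevel i C := #|[set u in C | #|u| == i]|.

(** If the new vertex lies in level [i.+1], the next vertex of the walk is an occupied one of level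
    [i], and it contributes 1 to the sum. *)
Lemma nlevel_step i C s : set0 \in C ->
  nlevel i.+1 (dla_step C s) <=
  nlevel i.+1 C + \sum_(u in C | #|u| == i) on_walk s u.
Proof.
move=> C0; have [CT|/(dla_stepP s C0)[h [hn hC _ ->]]] := boolP (setT \in C).
  by rewrite /dla_step CT leq_addr.
have [hi|hi] := eqVneq #|walk_vertex s h| i.+1.
  apply: (@leq_trans (nlevel i.+1 C + 1)).
    rewrite addnC -(cards1 (walk_vertex s h)) /nlevel.
    apply: leq_trans (leq_card_setU _ _); apply: subset_leq_card.
    by apply/subsetP => u; rewrite !inE => /andP[/predU1P[->|->] ->]; rewrite ?eqxx ?orbT.
  rewrite leq_add2l (bigD1 (walk_vertex s h.+1)) /=.
    by rewrite on_walk_vertex // leq_addr.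
  by rewrite hC card_walk_vertex; move: hi; rewrite card_walk_vertex; lia.
apply: leq_trans (leq_addr _ _); apply: subset_leq_card.
by apply/subsetP => u; rewrite !inE => /andP[/predU1P[->|->] ui] //; rewrite ui in hi.
Qed.

Lemma dla_step_fill C s v : set0 \in C -> setT \notin C -> v \notin C -> 0 < #|v| ->
  (forall u, #|u| = #|v|.-1 -> u \in C) -> on_walk s v ->
  (forall u, u \in C -> v \proper u -> ~~ on_walk s u) ->
  v \in dla_step C s.
Proof.
move=> C0 CT vC v0 below /eqP sv above.
have [h [hn hC hlt ->]] := dla_stepP s C0 CT.
have lv := card_leqn v.
(* Right after [v] the walk enters the full level below, so it stops no later than at [v]. *)
have h1 : h <= n - #|v|.
  rewrite leqNgt; apply/negP => lt; have /negP := hlt _ lt; apply; apply: below.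
  by rewrite card_walk_vertex; lia.
(* An earlier stop would be caused by an occupied vertex of the walk containing [v], and strictly so
   because [v] is empty. *)
have h2 : n - #|v| <= h.
  rewrite leqNgt; apply/negP => lt.
  have sub : v \subset walk_vertex s h.+1 by rewrite -sv subset_walk_vertex.
  suff /(above _ hC) : v \proper walk_vertex s h.+1 by rewrite on_walk_vertex.
  rewrite /proper sub /=; apply/negP => sub'; move: vC; have -> : v = walk_vertex s h.+1 by apply/eqP; rewrite eqEsubset sub.
  by rewrite hC.
have -> : h = n - #|v| by apply/eqP; rewrite eqn_leq h1.
by rewrite sv setU11.
Qed.

End Cluster.

(** * First moments of the levels and the blocking mass of a vertex *)

Section ClusterProbability.
Local Open Scope ring_scope.
Variables (R : realFieldType) (n : nat).
Implicit Types (s : {perm 'I_n}) (u v : {set 'I_n}) (C : {set {set 'I_n}}).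
Implicit Types w : seq {perm 'I_n}.
Let cg := card_perm_gt0 n.

Lemma avg_nlevel_step i C : set0 \in C ->
  avg (fun s => (nlevel i.+1 (dla_step C s))%:R : R) <=
  (nlevel i.+1 C)%:R + (nlevel i C)%:R / 'C(n, i)%:R.
Proof.
move=> C0.
apply: (le_trans (y := avg (fun s => (nlevel i.+1 C)%:R +
    \sum_(u in C | #|u| == i) (on_walk s u)%:R : R))).
  by apply: (le_avg cg) => s; rewrite -natr_sum -natrD ler_nat nlevel_step.
rewrite avgD (avg_const cg) lerD2l avg_sum.
under eq_bigr => u /andP[_ /eqP ui] do rewrite avg_on_walk ui.
rewrite sumr_const -[leLHS]mulr_natl /nlevel (eq_card (B := [set u in C | #|u| == i])) // => u.
by rewrite !inE.
Qed.

(** All times up to [T] are needed in the hypothesis: the growth of level [i.+1] adds up, walk by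
    walk, the expected size of level [i] at that moment. *)
Lemma expect_nlevel_succ i T (B : R) : (0 <= B) ->
  (forall t, (t <= T)%N -> expect t (fun w => (nlevel i (dla_cluster (n:=n) w))%:R) <= B) ->
  (forall t, (t <= T)%N -> expect t (fun w => (nlevel i.+1 (dla_cluster (n:=n) w))%:R)
      <= B * (T%:R / 'C(n, i)%:R)).
Proof.
move=> B0 H t tT.
apply: (le_trans (y := B * (t%:R / 'C(n, i)%:R))); last first.
  by rewrite ler_wpM2l // ler_wpM2r ?invr_ge0 ?ler0n // ler_nat.
elim: t tT => [|t IH] tT /=.
  rewrite /nlevel mul0r mulr0 (_ : [set _ in _ | _] = set0) ?cards0 //.
  by apply/setP => u; rewrite !inE; case: eqP => // ->; rewrite cards0.
apply: (le_trans (y := expect t (fun w => (nlevel i.+1 (dla_cluster (n:=n) w))%:R +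
    'C(n, i)%:R^-1 * (nlevel i (dla_cluster w))%:R))).
  apply: (le_expect cg) => w _.
  under eq_avg do rewrite dla_clusterS.
  by rewrite [in leRHS]mulrC avg_nlevel_step // set0_in_cluster.
rewrite (expectD cg) (expectZ cg) -[t.+1]addn1 natrD mulrDl mulrDr lerD ?IH 1?ltnW //.
by rewrite mul1r mulrC ler_wpM2r ?invr_ge0 ?ler0n // H // ltnW.
Qed.

Variable L : nat.

(* [weight v u] is the probability that a random walk conditioned to pass
   through [v] also passes through [u], so [blocking v C] bounds the
   probability that such a walk is stopped by [C] strictly above [v]. *)
Definition weight v u : R := 'C(n - #|v|, #|u| - #|v|)%:R^-1.

Definition blocking v C : R := \sum_(u in C | (v \proper u) && (#|u| < L)%N) weight v u.

(** The blocking mass that one walk would create if all its vertices were occupied. It depends on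
    the walk alone and not on the cluster, so its values along the process are independent. *)
Definition walk_blocking v s : R :=
  \sum_(u : {set 'I_n} | (v \proper u) && (#|u| < L)%N) (on_walk s u)%:R * weight v u.

Lemma weight_ge0 v u : 0 <= weight v u.
Proof. by rewrite invr_ge0 ler0n. Qed.

Lemma blocking_le C C' v : C \subset C' -> blocking v C <= blocking v C'.
Proof.
move=> CC; rewrite /blocking [leRHS](bigID (fun u => u \in C)) /=.
rewrite -[leLHS]addr0 lerD //; last by apply: sumr_ge0 => u _; exact: weight_ge0.
rewrite le_eqVlt; apply/orP; left; apply/eqP; apply: eq_bigl => u.
by case: (boolP (u \in C)) => [uC|]; rewrite ?andbF // (subsetP CC _ uC) andbT.
Qed.

(** A vertex added by a walk lies on that walk; charging its weight there replaces the dependent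
    cluster by an independent sum. *)
Lemma blocking_cluster v w :
  blocking v (dla_cluster w) <= \sum_(s <- w) walk_blocking v s.
Proof.
elim/last_ind: w => [|w s IH].
  rewrite big_nil /blocking big_pred0 // => u; rewrite inE.
  by case: eqP => // ->; rewrite properE sub0set andbF.
rewrite -cats1 big_cat big_seq1 cats1 dla_clusterS.
apply: le_trans (lerD IH (lexx _)); rewrite /blocking /walk_blocking.
rewrite !big_mkcondl /= -big_split /=; apply: ler_sum => u _.
case: ifP => [_|_]; last by rewrite addr0.
case: ifP => [/(dla_step_on_walk (set0_in_cluster w))|_].
  case: (u \in dla_cluster w) => /= [_|->]; last by rewrite add0r mul1r.
  by rewrite lerDl mulr_ge0 ?ler0n ?weight_ge0.
by rewrite addr_ge0 ?mulr_ge0 ?ler0n //; first case: ifP => // _; exact: weight_ge0.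
Qed.

Lemma avg_fill C v : set0 \in C -> setT \notin C -> v \notin C -> (0 < #|v|)%N ->
  (forall u, #|u| = #|v|.-1 -> u \in C) -> (forall u, u \in C -> (#|u| < L)%N) ->
  avg (fun s => (v \notin dla_step C s)%:R : R) <=
    1 - (1 - blocking v C) / 'C(n, #|v|)%:R.
Proof.
move=> C0 CT vC v0 below CL.
(* A union bound valid for each walk: [v] stays empty only if the walk misses [v], or passes through
   [v] and also through an occupied vertex above it. *)
pose f s : R := 1 + ((-1) * (on_walk s v)%:R +
  \sum_(u in C | v \proper u) (on_walk s u && on_walk s v)%:R).
apply: (le_trans (y := avg f)).
  apply: (le_avg cg) => s; rewrite /f.
  have S0 : 0 <= \sum_(u in C | v \proper u) (on_walk s u && on_walk s v)%:R :> R.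
    by apply: sumr_ge0 => u _; exact: ler0n.
  case: (boolP (on_walk s v)) S0 => sv S0; last first.
    by rewrite mulr0 add0r; case: (_ \notin _) => /=; lra.
  rewrite mulr1 addrA subrr add0r.
  case: (boolP [exists u in C, (v \proper u) && on_walk s u]) => [/existsP[u /and3P[uC vu su]]|].
    rewrite (bigD1 u) ?uC //= su /=.
    apply: (le_trans (y := 1)); first by case: (_ \notin _) => //=; rewrite ler01.
    by rewrite lerDl; apply: sumr_ge0 => u' _; exact: ler0n.
  rewrite negb_exists => /forallP no.
  rewrite (dla_step_fill C0 CT vC v0 below sv) //.
  by move=> u uC vu; move: (no u); rewrite uC vu.
rewrite /f avgD (avg_const cg) lerD2l avgD avgZ avg_on_walk avg_sum.
rewrite mulrBl opprB mul1r mulN1r addrC lerD2r le_eqVlt; apply/orP; left; apply/eqP.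
rewrite /blocking mulr_suml; apply: eq_big => [u|u /andP[uC vu]].
  by case: (boolP (u \in C)) => //= uC; rewrite CL // andbT.
rewrite avg_on_flag; last exact: proper_sub.
have lvu : (#|v| <= #|u|)%N by rewrite subset_leq_card // proper_sub.
have lun := card_leqn u.
rewrite -invfM; congr (_^-1); rewrite -!natrM; congr (_%:R).
by rewrite [RHS]mulnC bin_mul_bin ?lvu.
Qed.

End ClusterProbability.

(** * Concentration of the blocking mass *)

Lemma bin_double n i : 3 * i.+1 <= n -> 2 * 'C(n, i) <= 'C(n, i.+1).
Proof.
move=> lin; rewrite -(leq_pmul2l (ltn0Sn i)) mul_bin_left mulnA leq_mul2r.
by apply/orP; right; lia.
Qed.

Section Concentration.
Local Open Scope ring_scope.
Variables (R : realType) (n L : nat).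
Implicit Types (s : {perm 'I_n}) (v : {set 'I_n}).
Let cg := card_perm_gt0 n.

(** By [bin_double] each term is at most half of the preceding one, so the sum is at most twice its
    first term. *)
Lemma sum_inv_bin m a b : (3 * b <= m)%N ->
  \sum_(a <= i < b) 'C(m, i)%:R^-1 <= 2 / 'C(m, a)%:R :> R.
Proof.
move=> bm; elim: {a}(b - a)%N {-2}a (erefl (b - a)%N) => [|d IH] a E.
  by rewrite big_geq ?divr_ge0 ?ler0n //; lia.
rewrite big_ltn; last by lia.
have {}IH := IH a.+1 ltac:(lia).
have D : (3 * a.+1 <= m)%N by lia.
have C0 : (0 < 'C(m, a))%N by rewrite bin_gt0; lia.
have := bin_double D; move: IH C0.
set x := 'C(m, a); set y := 'C(m, a.+1) => IH x0 xy.
have xr : 0 < x%:R :> R by rewrite ltr0n.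
have : 2 / y%:R <= x%:R^-1 :> R.
  rewrite ler_pdivrMr; last by rewrite ltr0n; lia.
  by rewrite mulrC ler_pdivlMr // -natrM ler_nat.
by move=> H; apply: (le_trans (lerD (lexx _) (le_trans IH H))); rewrite -mulr2n mulr_natl.
Qed.

Lemma sum_supersets v (F : {set 'I_n} -> R) :
  \sum_(u : {set 'I_n} | (v \proper u) && (#|u| < L)%N) F u =
  \sum_(#|v|.+1 <= i < L) \sum_(u : {set 'I_n} | (v \subset u) && (#|u| == i)) F u.
Proof.
have [Lv|vL] := leqP L #|v|.
  rewrite big_geq ?big_pred0 //; last by lia.
  move=> u; apply/negP => /andP[/proper_card vu uL].
  by have := leq_trans vu (ltnW (leq_trans uL Lv)); rewrite ltnn.
rewrite -(subnKC vL); elim: (L - #|v|.+1)%N => [|d IH].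
  rewrite addn0 big_geq ?big_pred0 // => u.
  apply/negP => /andP[/proper_card vu uL].
  by have := leq_trans vu (uL : #|u| <= #|v|)%N; rewrite ltnn.
rewrite addnS big_nat_recr ?leq_addr //= -IH (bigID (fun u : {set 'I_n} => #|u| < #|v|.+1 + d)%N) /=.
congr (_ + _); apply: eq_bigl => u.
  case: (v \proper u) => //=; rewrite ltnS.
  by case: ltnP => H; rewrite ?(ltnW H) ?andbT ?andbF.
rewrite ltnS -leqNgt -andbA -eqn_leq properEcard -andbA.
case: (v \subset u) => //=; case: eqP => [->|]; last by rewrite andbF.
by rewrite andbT leq_addr.
Qed.

Hypothesis Ln : (3 * L <= n)%N.

Lemma sum_shift_bin v : (#|v| < L)%N ->
  \sum_(#|v|.+1 <= i < L) 'C(n - #|v|, i - #|v|)%:R^-1 <= 2 / (n - #|v|)%:R :> R.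
Proof.
move=> vL; rewrite -{1}(add0n #|v|.+1) -addn1 addnA -(subnK (ltnW vL)) add0n addnC big_addn.
rewrite addnK.
under eq_bigr do rewrite addnK.
by rewrite (le_trans (sum_inv_bin _ _)) ?bin1 //; lia.
Qed.

(** The walk has only one vertex in each level, and the level just above [v] dominates the sum of
    the weights. *)
Lemma walk_blocking_le v s : (#|v| < L)%N ->
  walk_blocking R L v s <= 2 / (n - #|v|)%:R.
Proof.
move=> vL; apply: le_trans (sum_shift_bin vL).
rewrite /walk_blocking sum_supersets big_nat [leRHS]big_nat.
apply: ler_sum => i /andP[vi iL].
have -> : 'C(n - #|v|, i - #|v|)%:R^-1 = 1 * 'C(n - #|v|, i - #|v|)%:R^-1 :> R by rewrite mul1r.
rewrite (eq_bigr (fun u => (on_walk s u)%:R * 'C(n - #|v|, i - #|v|)%:R^-1)); last first.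
  by move=> u /andP[_ /eqP <-].
rewrite -mulr_suml ler_wpM2r ?invr_ge0 ?ler0n //.
rewrite -natr_sum -[X in _ <= X]/(1%:R) ler_nat -big_mkcondr /= sum1dep_card.
rewrite -(cards1 (walk_vertex s (n - i))); apply: subset_leq_card; apply/subsetP => u.
by rewrite !inE => /andP[/andP[_ /eqP <-]] /eqP {1}<-.
Qed.

(** In each level the number of vertices above [v] cancels the weight, which leaves the sum of the
    inverses of ['C(n, i)]. *)
Lemma avg_walk_blocking_le v : (#|v| < L)%N ->
  avg (walk_blocking R L v) <= 2 / 'C(n, #|v|.+1)%:R.
Proof.
move=> vL; apply: le_trans (sum_inv_bin _ Ln).
rewrite /walk_blocking avg_sum sum_supersets big_nat [leRHS]big_nat.
apply: ler_sum => i /andP[vi iL].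
rewrite (eq_bigr (fun u => 'C(n, i)%:R^-1 / 'C(n - #|v|, i - #|v|)%:R)); last first.
  move=> u /andP[_ /eqP ui]; under eq_avg do rewrite mulrC.
  by rewrite avgZ avg_on_walk /weight ui mulrC.
rewrite sumr_const -[leLHS]mulr_natr.
rewrite (eq_card (B := [set u : {set 'I_n} | (v \subset u) && (#|u| == i)])); last by move=> u; rewrite !inE.
rewrite card_supersets; last by apply/andP; split; lia.
rewrite divfK // pnatr_eq0 -lt0n bin_gt0; lia.
Qed.

Lemma expR_le1D2x (x : R) : 0 <= x <= 2^-1 -> expR x <= 1 + 2 * x.
Proof.
case/andP => x0 x1; have := expR_ge1Dx (- x); rewrite expRN => H.
have e0 := expR_gt0 x.
have : (1 - x) * expR x <= 1 by rewrite -ler_pdivlMr // mul1r.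
nra.
Qed.

Lemma expRN_le_pow2 m (x : R) : m%:R <= x -> expR (- x) <= 2 ^- m.
Proof.
move=> mx; rewrite expRN lef_pV2 ?posrE ?expR_gt0 ?exprn_gt0 //.
apply: (le_trans (y := expR m%:R)); last by rewrite ler_expR.
rewrite -[m%:R]mulr1 expRM_natl lerXn2r ?nnegrE ?expR_ge0 //.
by have := expR_ge1Dx (1 : R).
Qed.

Lemma blocking_tail v T : (#|v| < L)%N -> (16 * T <= 'C(n, #|v|.+1))%N ->
  expect T (fun w => ((2^-1 < blocking R L v (dla_cluster w))%R : bool)%:R) <=
  expR (- ((n - #|v|)%:R / 16)) :> R.
Proof.
(* Chernoff parameter: [lam] times the bound of [walk_blocking_le] is 1/2, the limit of
   [expR_le1D2x]. The threshold 1/2 contributes [- lam / 2] to the exponent and the mean at most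
   [lam / 4]. *)
move=> vL TC; pose lam : R := (n - #|v|)%:R / 4.
have nv : 0 < (n - #|v|)%:R :> R by rewrite ltr0n; lia.
have lam0 : 0 < lam by rewrite divr_gt0.
have Cg : 0 < 'C(n, #|v|.+1)%:R :> R by rewrite ltr0n bin_gt0; lia.
pose h s := expR (lam * walk_blocking R L v s).
have hle s : h s <= 1 + (2 * lam) * walk_blocking R L v s.
  have Y0 : 0 <= walk_blocking R L v s.
    by apply: sumr_ge0 => u _; rewrite mulr_ge0 ?ler0n ?weight_ge0.
  have Y1 := walk_blocking_le s vL.
  have Yl : lam * walk_blocking R L v s <= 2^-1.
    apply: le_trans (ler_wpM2l (ltW lam0) Y1) _; rewrite /lam.
    rewrite le_eqVlt; apply/orP; left; apply/eqP; field; exact: lt0r_neq0.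
  by rewrite -mulrA expR_le1D2x // Yl mulr_ge0 // ltW.
have avgh : avg h <= expR (4 * lam / 'C(n, #|v|.+1)%:R).
  apply: le_trans (le_avg cg hle) _.
  rewrite avgD (avg_const cg) avgZ; apply: le_trans (expR_ge1Dx _).
  rewrite lerD2l; apply: le_trans (ler_wpM2l _ (avg_walk_blocking_le vL)) _.
    by rewrite mulr_ge0 // ltW.
  by rewrite le_eqVlt; apply/orP; left; apply/eqP; field; exact: lt0r_neq0.
have avgh0 : 0 <= avg h.
  by rewrite -(avg_const cg 0); apply: (le_avg cg) => s; exact: expR_ge0.
apply: (le_trans (y := expR (- (lam / 2)) * avg h ^+ T)).
  rewrite -expect_prod // -(expectZ cg); apply: (le_expect cg) => w _.
  rewrite /h -expR_sum -mulr_sumr -expRD.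
  case: ltP => [bl|_]; last exact: expR_ge0.
  rewrite -[X in X <= _]expR0 ler_expR.
  have := lt_le_trans bl (blocking_cluster R L v w).
  move=> H; have := ltr_pM2l lam0 2^-1 (\sum_(s <- w) walk_blocking R L v s).
  by rewrite H; lra.
apply: (le_trans (y := expR (- (lam / 2)) * expR (4 * lam / 'C(n, #|v|.+1)%:R) ^+ T)).
  by rewrite ler_wpM2l ?expR_ge0 // lerXn2r // nnegrE ?expR_ge0.
rewrite -expRM_natl -expRD ler_expR.
have : T%:R * (4 * lam / 'C(n, #|v|.+1)%:R) <= lam / 4.
  rewrite mulrA ler_pdivrMr //.
  have : (16 * T)%:R <= 'C(n, #|v|.+1)%:R :> R by rewrite ler_nat.
  rewrite natrM => H; nra.
rewrite /lam; lra.
Qed.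

End Concentration.

(** * Binomial estimates for the time schedule *)

Lemma bin_leq_exp n k : 'C(n, k) <= n ^ k.
Proof.
elim: k => [|k IH]; first by rewrite bin0.
rewrite expnS (leq_trans _ (leq_mul (leqnn n) IH)) //.
apply: (@leq_trans (k.+1 * 'C(n, k.+1))); first exact: leq_pmull.
by rewrite mul_bin_left leq_mul2r leq_subr orbT.
Qed.

Lemma bin_leq_exp2 n k : 'C(n, k) <= 2 ^ n.
Proof.
rewrite -[X in 'C(X, _)](card_ord n) -card_draws.
by apply: leq_trans (max_card _) _; rewrite -cardsT -powersetT card_powerset cardsT card_ord.
Qed.

Lemma leq_bin_add n k d : 3 * (k + d) <= n -> 'C(n, k) <= 'C(n, k + d).
Proof.
elim: d => [|d IH] kd; first by rewrite addn0.
rewrite addnS; apply: leq_trans (IH _) _; first by lia.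
by have := @bin_double n (k + d) ltac:(lia); lia.
Qed.

Section Schedule.
Variables n k l : nat.
Hypotheses (k_gt0 : 0 < k) (l_gt0 : 0 < l) (kln : 1000 * (k * k * l) <= n).

(* Level [j] is shown to be full at time [fill_time j], at which no vertex of
   level [top_level] or above is occupied; [l] stands for the binary logarithm
   of [n] and [k] for the integer part of k_0. *)
Definition fill_time j := 12 * (k * l) * 'C(n, j).
Definition top_level := k + 3 + (k + 2).

Lemma k_le_kkl : k <= k * k * l.
Proof. by rewrite -mulnA leq_pmulr // muln_gt0 k_gt0. Qed.

Lemma kl_le_kkl : k * l <= k * k * l.
Proof. by rewrite -mulnA leq_pmull. Qed.

Lemma top_level_le : 3 * top_level <= n.
Proof. by have := k_le_kkl; rewrite /top_level; lia. Qed.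

(** The ratio [(n - j) / (j + 1)] of consecutive binomials exceeds 16 times [12 * (k * l)] because
    [n] is at least [1000 * (k * k * l)]. This is the time bound required by [blocking_tail]. *)
Lemma fill_time_le_next j : j <= k -> 16 * fill_time j <= 'C(n, j.+1).
Proof.
move=> jk; rewrite -(leq_pmul2l (ltn0Sn j)) mul_bin_left /fill_time !mulnA leq_mul2r.
apply/orP; right.
have kk := k_le_kkl; have : j.+1 * (k * l) <= 2 * (k * k * l).
  rewrite (_ : 2 * (k * k * l) = 2 * k * (k * l)); last by ring.
  by rewrite leq_mul2r; apply/orP; right; lia.
lia.
Qed.

Lemma fill_time_double j : j < k -> 2 * fill_time j <= fill_time j.+1.
Proof.
move=> jk; rewrite /fill_time mulnCA leq_mul2l bin_double ?orbT //.
by have := k_le_kkl; lia.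
Qed.

Lemma leq_fill_time j : j <= k -> fill_time j <= fill_time k.
Proof.
move=> jk; rewrite /fill_time leq_mul2l -(subnKC jk) leq_bin_add ?orbT //.
by have := k_le_kkl; lia.
Qed.

Lemma fill_time_le_exp2 : fill_time k <= 2 ^ n.
Proof. by apply: leq_trans (bin_leq_exp2 n k.+1); have := fill_time_le_next (leqnn k); lia. Qed.

Lemma fill_time_le_exp : fill_time k <= n ^ k.+1.
Proof. by apply: leq_trans (bin_leq_exp n k.+1); have := fill_time_le_next (leqnn k); lia. Qed.

Lemma fill_time_le_bin i : k < i <= top_level -> fill_time k <= 'C(n, i).
Proof.
case/andP => ki iL; apply: (@leq_trans 'C(n, k.+1)).
  by have := fill_time_le_next (leqnn k); lia.
rewrite -(subnKC ki) leq_bin_add //; have := top_level_le; lia.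
Qed.

(** From level [k + 1] to level [k + 3] the binomial grows by the factor (n-k-1)(n-k-2) /
    ((k+2)(k+3)), which is at least [n]. *)
Lemma fill_time_mul_le_bin i : k + 3 <= i <= top_level -> fill_time k * n <= 'C(n, i).
Proof.
case/andP => ki iL; apply: (@leq_trans ('C(n, k.+1) * n)).
  by rewrite leq_mul2r; have := fill_time_le_next (leqnn k); lia.
apply: (@leq_trans 'C(n, k + 3)); last first.
  rewrite -(subnKC ki) leq_bin_add //; have := top_level_le; lia.
have E1 := mul_bin_left n k.+1; have E2 := mul_bin_left n k.+2.
have kk := k_le_kkl.
rewrite addn3 -(@leq_pmul2l (k.+3 * k.+2)) ?muln_gt0 //.
have -> : k.+3 * k.+2 * 'C(n, k.+3) = (n - k.+2) * (n - k.+1) * 'C(n, k.+1).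
  by rewrite mulnAC E2 -!mulnA [_ * k.+2]mulnC E1 mulnA.
rewrite (_ : _ * (_ * n) = n * (k.+3 * k.+2) * 'C(n, k.+1)); last by ring.
rewrite leq_mul2r; apply/orP; right.
have H1 : k.+3 * k.+2 <= 12 * (k * k * l).
  apply: (@leq_trans (12 * (k * k))); last by rewrite leq_mul2l leq_pmulr.
  nia.
have H2 : n * (48 * (k * k * l)) <= n * n by rewrite leq_mul2l; apply/orP; right; lia.
have H3 : n <= 2 * (n - k.+2) by lia.
have H4 : n <= 2 * (n - k.+1) by lia.
have H5 := leq_mul H3 H4.
have H6 : n * (k.+3 * k.+2) <= n * (12 * (k * k * l)) by rewrite leq_mul2l H1 orbT.
nia.
Qed.

End Schedule.

(** * Union bound *)

Lemma card_small_sets n k : 0 < k -> k < n ->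
  #|[set v : {set 'I_n} | 0 < #|v| <= k]| <= n ^ k.+1.
Proof.
move=> k0 kn; apply: (@leq_trans (\sum_(j < k.+1) 'C(n, j))).
  rewrite (eq_bigr (fun j : 'I_k.+1 => #|[set v : {set 'I_n} | #|v| == j]|)); last first.
    by move=> j _; rewrite card_draws card_ord.
  apply: (@leq_trans #|\bigcup_(j < k.+1) [set v : {set 'I_n} | #|v| == j]|).
    apply: subset_leq_card; apply/subsetP => v; rewrite inE => /andP[_ vk].
    by apply/bigcupP; exists (Ordinal (vk : #|v| < k.+1)) => //; rewrite inE.
  elim/big_rec2: _ => [|j m A _ IH]; first by rewrite cards0.
  apply: leq_trans (leq_card_setU _ _) _; by rewrite leq_add2l.
apply: (@leq_trans (\sum_(j < k.+1) n ^ k)).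
  apply: leq_sum => j _; apply: leq_trans (bin_leq_exp _ _) _.
  by rewrite leq_pexp2l ?(leq_trans _ kn) // -ltnS ltn_ord.
by rewrite sum_nat_const card_ord expnS leq_mul2r kn orbT.
Qed.

(** * Failure probabilities of the filling events *)

Section Filling.
Local Open Scope ring_scope.
Variable R : realType.
Variables n k l : nat.
Hypotheses (k_gt0 : (0 < k)%N) (l_gt0 : (0 < l)%N) (kln : (1000 * (k * k * l) <= n)%N).
Hypothesis nl : (n <= 2 ^ l)%N.
Implicit Types (s : {perm 'I_n}) (u v : {set 'I_n}) (C : {set {set 'I_n}}).
Implicit Types w : seq {perm 'I_n}.
Let cg := card_perm_gt0 n.
Let T := fill_time n k l.
Let L := top_level k.

Let n_gt0 : (0 < n)%N.
Proof. by have := k_le_kkl k_gt0 l_gt0; lia. Qed.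

Let nR_gt0 : 0 < n%:R :> R.
Proof. by rewrite ltr0n. Qed.

(* The expected number of occupied vertices is multiplied by at most
   T/C(n, i) from level [i] to level [i.+1], where T is the time; this ratio is
   at most 1/n from level [k + 3] on. *)
Lemma expect_top_level :
  expect (T k) (fun w => (nlevel L (dla_cluster (n:=n) w))%:R) <= n%:R^-1 :> R.
Proof.
have Lb := top_level_le k_gt0 l_gt0 kln.
have T0 : 0 <= (T k)%:R :> R by rewrite ler0n.
have step i (B : R) : (k < i <= L)%N -> 0 <= B ->
  (forall t, (t <= T k)%N -> expect t (fun w => (nlevel i (dla_cluster (n:=n) w))%:R) <= B) ->
  (forall t, (t <= T k)%N -> expect t (fun w => (nlevel i.+1 (dla_cluster (n:=n) w))%:R) <= B).
  move=> ki B0 H t tT; apply: le_trans (expect_nlevel_succ B0 H tT) _.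
  rewrite -[leRHS]mulr1 ler_wpM2l // ler_pdivrMr ?mul1r ?ler_nat; first exact: fill_time_le_bin.
  by rewrite ltr0n bin_gt0; move: ki; rewrite /L; lia.
have X0 t : (t <= T k)%N ->
    expect t (fun w => (nlevel k (dla_cluster (n:=n) w))%:R) <= 'C(n, k)%:R :> R.
  move=> _; rewrite -[leRHS](expect_const cg t); apply: (le_expect cg) => w _.
  rewrite ler_nat -[X in 'C(X, _)](card_ord n) -card_draws; apply: subset_leq_card.
  by apply/subsetP => u; rewrite !inE => /andP[].
have X1 t : (t <= T k)%N ->
    expect t (fun w => (nlevel k.+1 (dla_cluster (n:=n) w))%:R) <= (T k)%:R :> R.
  move=> tT; apply: le_trans (expect_nlevel_succ (ler0n _ _) X0 tT) _.
  rewrite mulrC divfK // pnatr_eq0 -lt0n bin_gt0; have := k_le_kkl k_gt0 l_gt0; lia.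
have X3 := step _ _ _ T0 (step _ _ _ T0 X1).
have {}X3 := X3 ltac:(rewrite /L /top_level; lia) ltac:(rewrite /L /top_level; lia).
have Xm m : (m <= k + 2)%N -> forall t, (t <= T k)%N ->
    expect t (fun w => (nlevel (k + 3 + m)%N (dla_cluster (n:=n) w))%:R) <=
    (T k)%:R * n%:R^-1 ^+ m :> R.
  elim: m => [|m IH] mk t tT; first by rewrite addn0 addn3 expr0 mulr1 X3.
  have B0 : 0 <= (T k)%:R * n%:R^-1 ^+ m :> R by rewrite mulr_ge0 ?exprn_ge0 ?invr_ge0.
  rewrite addnS; apply: le_trans (expect_nlevel_succ B0 (IH (ltnW mk)) tT) _.
  rewrite exprSr mulrA ler_wpM2l // ler_pdivrMr; last first.
    by rewrite ltr0n bin_gt0; move: Lb; rewrite /top_level; lia.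
  rewrite mulrC ler_pdivlMr // -natrM ler_nat; apply: fill_time_mul_le_bin => //.
  by rewrite /top_level; lia.
apply: le_trans (Xm (k + 2)%N (leqnn _) (T k) (leqnn _)) _.
(* The time is at most [n ^ k.+1], and the [k + 2] levels above [k + 3] each gain a factor 1/n; this
   is what fixes the height [top_level]. *)
have := fill_time_le_exp k_gt0 l_gt0 kln; rewrite -/(T k) => H.
apply: (le_trans (y := (n ^ k.+1)%:R * n%:R^-1 ^+ (k + 2))).
  by rewrite ler_wpM2r ?ler_nat // exprn_ge0 // invr_ge0.
rewrite natrX addn2 [X in _ * X]exprS mulrCA -exprMn divff ?expr1n ?mulr1 //; exact: lt0r_neq0.
Qed.

(* One walk fills [v] with probability at least 1/(2 C(n, |v|)) as long as
   the cluster satisfies [unfilled v]. *)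
Definition unfilled v C := [&& v \notin C, setT \notin C, set0 \in C,
  [forall u : {set 'I_n}, (#|u| == #|v|.-1)%N ==> (u \in C)],
  [forall u : {set 'I_n}, (u \in C) ==> (#|u| < L)%N] & blocking R L v C <= 2^-1].

(** Tested only at the end of the window of [v]: the blocking mass grows with the cluster, so a
    small final value bounds it throughout. *)
Definition blocked_early v w : bool := 2^-1 < blocking R L v (dla_cluster w).

Definition stays_unfilled v w :=
  all (fun t => unfilled v (dla_cluster (take t w)))
    (iota (T #|v|.-1) (T #|v| - T #|v|.-1).+1).

(** The failure probability allowed per vertex: against at most [n ^ k.+1] vertices it leaves a
    total of order 1/n. *)
Lemma pow2_le : 2 ^- ((k + 2) * l) <= n%:R^-1 ^+ k.+2 :> R.
Proof.
rewrite mulnC exprM -exprVn addn2 lerXn2r ?nnegrE ?invr_ge0 ?exprn_ge0 //.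
by rewrite lef_pV2 ?posrE ?exprn_gt0 // -natrX ler_nat.
Qed.

Lemma expect_blocked_early v : (0 < #|v| <= k)%N ->
  expect (T #|v|) (fun w => (blocked_early v w)%:R) <= n%:R^-1 ^+ k.+2 :> R.
Proof.
case/andP => v0 vk; apply: le_trans pow2_le.
have Lb := top_level_le k_gt0 l_gt0 kln.
have vL : (#|v| < L)%N by rewrite /L /top_level; lia.
apply: le_trans (blocking_tail R Lb vL (fill_time_le_next k_gt0 l_gt0 kln vk)) _.
apply: expRN_le_pow2; rewrite ler_pdivlMr // -natrM ler_nat.
have kk := k_le_kkl k_gt0 l_gt0; have kl := kl_le_kkl l k_gt0.
have : ((k + 2) * l <= 3 * (k * l))%N by rewrite mulnA leq_mul2r; lia.
lia.
Qed.

Lemma expect_stays_unfilled v : (0 < #|v| <= k)%N ->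
  expect (T #|v|) (fun w => (stays_unfilled v w)%:R) <= n%:R^-1 ^+ k.+2 :> R.
Proof.
case/andP => v0 vk; apply: le_trans pow2_le.
have vE : #|v|.-1.+1 = #|v| by rewrite prednK.
have TT : (2 * T #|v|.-1 <= T #|v|)%N.
  by rewrite -[in leqRHS]vE; apply: fill_time_double => //; rewrite vE.
(* The probability with which a walk at least fills [v] when the blocking mass is at most 1/2. *)
pose x : R := (2 * 'C(n, #|v|))%:R^-1.
have kk := k_le_kkl k_gt0 l_gt0.
have c_gt0 : (0 < 'C(n, #|v|))%N by rewrite bin_gt0 card_leqn.
have cR : 0 < 'C(n, #|v|)%:R :> R by rewrite ltr0n.
have x1 : x <= 1 by rewrite invf_le1 ?ltr0n ?ler1n; lia.
have q0 : 0 <= 1 - x by rewrite subr_ge0.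
have stepq C : unfilled v C -> avg (fun s => (unfilled v (dla_step C s))%:R) <= 1 - x.
  case/and5P => vC CT C0 /forallP below /andP[/forallP CL bl].
  apply: (le_trans (y := avg (fun s => (v \notin dla_step C s)%:R))).
    by apply: (le_avg cg) => s; rewrite ler_nat /unfilled; case: (v \notin _); rewrite ?leq_b1.
  apply: le_trans (avg_fill (L := L) _ C0 CT vC v0 _ _) _.
  - by move=> u /eqP uv; move: (below u); rewrite uv.
  - by move=> u uC; move: (CL u); rewrite uC.
  rewrite lerD2l lerN2 /x natrM invfM ler_wpM2r ?invr_ge0 ?(ltW cR) //; lra.
have := expect_stay cg [set set0] q0 stepq (T #|v|.-1) (T #|v| - T #|v|.-1).
rewrite subnKC; last by lia.
move=> H; apply: le_trans H _.
apply: (le_trans (y := expR (- x) ^+ (T #|v| - T #|v|.-1))).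
  by rewrite lerXn2r ?nnegrE ?expR_ge0 //; have := expR_ge1Dx (- x).
rewrite -expRM_natl mulrN; apply: expRN_le_pow2.
rewrite ler_pdivlMr; last by rewrite ltr0n; lia.
rewrite -natrM ler_nat.
(* The window keeps at least half of [T #|v|], that is [6 * (k * l) * 'C(n, #|v|)] walks, so the
   exponent is at least [3 * (k * l)], hence at least [(k + 2) * l]. *)
apply: (@leq_trans (6 * (k * l) * 'C(n, #|v|))).
  rewrite mulnA leq_mul2r; apply/orP; right.
  have : ((k + 2) * l <= 3 * (k * l))%N by rewrite mulnA leq_mul2r; lia.
  lia.
by move: TT; rewrite /T /fill_time; lia.
Qed.

(** The deterministic part, by induction on the level: a vertex still empty at its fill time would
    have been [unfilled] during its whole window, which is excluded. *)
Lemma filled_of_good w :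
  nlevel L (dla_cluster (take (T k) w)) = 0%N ->
  (forall v, (0 < #|v| <= k)%N -> ~~ blocked_early v (take (T #|v|) w)) ->
  (forall v, (0 < #|v| <= k)%N -> ~~ stays_unfilled v (take (T #|v|) w)) ->
  forall v, (#|v| <= k)%N -> v \in dla_cluster w.
Proof.
move=> topE nb ns.
have low t u : (t <= T k)%N -> u \in dla_cluster (take t w) -> (#|u| < L)%N.
  move=> tT uC; rewrite ltnNge; apply/negP => Lu.
  have [u' u'C u'L] := cluster_level_below uC Lu.
  have := card0_eq topE u'; rewrite inE u'L eqxx andbT.
  by rewrite (subsetP (dla_cluster_take w tT) _ u'C).
have Tmono j : (j <= k)%N -> (T j <= T k)%N by exact: leq_fill_time.
have Lb := top_level_le k_gt0 l_gt0 kln.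
suff fill j : (j <= k)%N -> forall v, #|v| = j -> v \in dla_cluster (take (T j) w).
  move=> v vk; have := fill _ vk v erefl.
  rewrite -{2}(cat_take_drop (T #|v|) w); exact/subsetP/dla_cluster_cat.
elim: j => [|j IH] jk v vj; first by rewrite (cards0_eq vj) set0_in_cluster.
apply/negPn/negP => vC.
have vk : (0 < #|v| <= k)%N by rewrite vj.
case/negP: (ns v vk); apply/allP => t; rewrite mem_iota vj /= => /andP[t1 t2].
have T2 := fill_time_double k_gt0 l_gt0 kln jk.
have {}t2 : (t <= T j.+1)%N by move: t2; rewrite addnS ltnS subnKC //; rewrite /T; lia.
have tk := leq_trans t2 (Tmono _ jk).
rewrite take_takel //; apply/and5P; split; last (apply/andP; split).
- by apply: contra vC; exact/subsetP/dla_cluster_take.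
- apply/negP => /(low _ _ tk); rewrite cardsT card_ord; lia.
- exact: set0_in_cluster.
- apply/forallP => u; apply/implyP; rewrite vj /= => /eqP uj.
  exact: (subsetP (dla_cluster_take w t1)) _ (IH (ltnW jk) u uj).
- by apply/forallP => u; apply/implyP; exact: low.
- have := nb v vk; rewrite /blocked_early -leNgt vj; apply: le_trans.
  exact/blocking_le/dla_cluster_take.
Qed.

Definition low_filled w := [forall v : {set 'I_n}, (#|v| <= k)%N ==> (v \in dla_cluster w)].

Lemma expect_not_low_filled :
  expect (2 ^ n) (fun w => (~~ low_filled w)%:R) <= 3 / n%:R :> R.
Proof.
have Tle j : (j <= k)%N -> (T j <= 2 ^ n)%N.
  move=> jk; apply: leq_trans (leq_fill_time k_gt0 l_gt0 kln jk) _.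
  exact: fill_time_le_exp2.
pose P v := (0 < #|v| <= k)%N.
(* On failure some term of this sum of natural numbers is at least 1. Linearity then gives the union
   bound, each term being evaluated at its own time. *)
apply: (le_trans (y := expect (2 ^ n) (fun w =>
   (nlevel L (dla_cluster (take (T k) w)))%:R +
   \sum_(v | P v) ((blocked_early v (take (T #|v|) w))%:R +
                   (stays_unfilled v (take (T #|v|) w))%:R)))).
  apply: (le_expect cg) => w _.
  have S0 (Q : pred {set 'I_n}) : 0 <= \sum_(v | Q v) ((blocked_early v (take (T #|v|) w))%:R +
                   (stays_unfilled v (take (T #|v|) w))%:R) :> R.
    by apply: sumr_ge0 => v _; rewrite addr_ge0 ?ler0n.
  case: (posnP (nlevel L (dla_cluster (take (T k) w)))) => [E|pos]; last first.
    apply: (le_trans (y := 1)); first by case: (~~ _); rewrite ?ler01.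
    by rewrite -[leLHS]addr0; apply: lerD; rewrite ?ler1n //; exact: S0.
  rewrite E add0r.
  have one v : P v -> blocked_early v (take (T #|v|) w) || stays_unfilled v (take (T #|v|) w) ->
      (~~ low_filled w)%:R <= \sum_(v | P v) ((blocked_early v (take (T #|v|) w))%:R +
                   (stays_unfilled v (take (T #|v|) w))%:R) :> R.
    move=> Pv bs; apply: (le_trans (y := 1)); first by case: (~~ _); rewrite ?ler01.
    rewrite (bigD1 v) //= -[leLHS]addr0; apply: lerD; last exact: S0.
    by rewrite -natrD ler1n addn_gt0 !lt0b.
  have [/existsP[v /andP[Pv bs]]|] := boolP [exists v, P v &&
      (blocked_early v (take (T #|v|) w) || stays_unfilled v (take (T #|v|) w))].
    exact: one Pv bs.
  rewrite negb_exists => /forallP no.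
  have no' v : P v -> ~~ blocked_early v (take (T #|v|) w) /\ ~~ stays_unfilled v (take (T #|v|) w).
    by move=> Pv; move: (no v); rewrite Pv /= negb_or => /andP[].
  have -> : low_filled w; last exact: S0.
  apply/forallP => v; apply/implyP.
  by apply: filled_of_good => // u /no'[].
rewrite (expectD cg) (expect_sum cg).
have -> : 3 / n%:R = n%:R^-1 + 2 / n%:R :> R by field; exact: lt0r_neq0.
apply: lerD.
  rewrite (expect_take cg (fun w => (nlevel L (dla_cluster w))%:R) (Tle k (leqnn k))).
  exact: expect_top_level.
apply: (le_trans (y := \sum_(v | P v) (2 * n%:R^-1 ^+ k.+2))).
  apply: ler_sum => v Pv; have /andP[_ vk] := Pv.
  rewrite (expectD cg) (expect_take cg (fun w => (blocked_early v w)%:R) (Tle _ vk)).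
  rewrite (expect_take cg (fun w => (stays_unfilled v w)%:R) (Tle _ vk)).
  by rewrite mulr_natl mulr2n lerD ?expect_blocked_early ?expect_stays_unfilled.
rewrite sumr_const -[leLHS]mulr_natr.
have -> : 2 / n%:R = 2 * n%:R^-1 ^+ k.+2 * (n ^ k.+1)%:R :> R.
  rewrite natrX [X in _ * X * _]exprS -!mulrA -exprMn mulVf ?expr1n ?mulr1 //; exact: lt0r_neq0.
apply: ler_wpM2l; first by apply: mulr_ge0; rewrite // exprn_ge0 // invr_ge0.
rewrite ler_nat.
have kk := k_le_kkl k_gt0 l_gt0.
apply: leq_trans (card_small_sets k_gt0 _); last by lia.
by rewrite cardsE.
Qed.

Lemma card_not_low_filled :
  (#|[set w : sample_space n | ~~ low_filled [seq w i | i <- enum 'I_(nwalks n)]]| * n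
   <= 3 * #|[set: sample_space n]|)%N.
Proof.
rewrite -(ler_nat R) !natrM -ler_pdivlMr //.
rewrite cardsT card_ffun card_ord -sum1dep_card big_mkcond natr_sum.
rewrite (eq_bigr (fun w : sample_space n =>
    (~~ low_filled [seq w i | i <- enum 'I_(nwalks n)])%:R)); last by move=> w _; case: (~~ _).
rewrite (expect_ffun cg (nwalks n) (fun w => (~~ low_filled w)%:R)) natrX.
by rewrite mulrAC mulrC ler_wpM2r ?exprn_ge0 ?ler0n // expect_not_low_filled.
Qed.

End Filling.

(** * Real estimates *)

Section RealBounds.
Local Open Scope R_scope.

Lemma INR_muln a b : INR (muln a b) = INR a * INR b.
Proof. by rewrite -multE mult_INR. Qed.

Lemma INR_addn a b : INR (addn a b) = INR a + INR b.
Proof. by rewrite -plusE plus_INR. Qed.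

Lemma INR_leq a b : (a <= b)%N <-> INR a <= INR b.
Proof. by split=> [/ssrnat.leP /le_INR|/INR_le /ssrnat.leP]. Qed.

Lemma INR_expn2 m : INR (expn 2 m) = 2 ^ m.
Proof. by elim: m => // m IH; rewrite expnS INR_muln IH. Qed.

Lemma ln_ge_half n : (1 < n)%N -> / 2 < Rpower.ln (INR n).
Proof.
move=> n1; apply: Rlt_le_trans ln_lt_2 _.
have /INR_leq := n1; rewrite (INR_IZR_INZ 2) => -[H|<-]; last exact: Rle_refl.
by apply/Rlt_le/ln_increasing => //; Lra.lra.
Qed.

(** With [l] the rounded-up logarithm, 2^(l-1) < n and ln 2 > 1/2 give l - 1 <= 2 ln n, and 1 < 2 ln
    n absorbs the rounding. *)
Lemma up_log_le_ln n : (1 < n)%N -> INR (up_log 2 n) <= 4 * Rpower.ln (INR n).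
Proof.
move=> n1; have l0 : (0 < up_log 2 n)%N by rewrite up_log_gt0.
have /andP[lo _] := up_log_bounds (isT : 1 < 2)%N n1.
have half := ln_ge_half n1.
have : INR (up_log 2 n).-1 * Rpower.ln 2 <= Rpower.ln (INR n).
  rewrite -ln_pow; last Lra.lra.
  rewrite -INR_expn2.
  have : 0 < INR (expn 2 (up_log 2 n).-1) by rewrite INR_expn2; apply: pow_lt; Lra.lra.
  move=> p; have /INR_leq := ltnW lo.
  case=> [/(ln_increasing _ _ p)|->]; Lra.lra.
have -> : INR (up_log 2 n) = INR (up_log 2 n).-1 + 1 by rewrite -S_INR prednK.
have := ln_lt_2; have := pos_INR (up_log 2 n).-1.
set m := INR _; move=> m0 h H.
have : m * / 2 <= m * Rpower.ln 2 by apply: Rmult_le_compat_l; Lra.lra.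
Lra.lra.
Qed.

(** The constant 4000 is 1000, asked by the time schedule, times the 4 of [up_log_le_ln]. *)
Lemma k0_bound n j : (1 < n)%N -> INR j <= k0_of (/ 4000) n ->
  (1000 * (j * j * up_log 2 n) <= n)%N.
Proof.
move=> n1 jk; apply/INR_leq; rewrite !INR_muln.
have -> : INR 1000 = 1000 by rewrite INR_IZR_INZ.
have half := ln_ge_half n1; have lb := up_log_le_ln n1.
have n0 := pos_INR n; have j0 := pos_INR j.
have x0 : 0 <= / 4000 * INR n / Rpower.ln (INR n).
  apply: Rmult_le_pos; first Lra.lra.
  by apply/Rlt_le/Rinv_0_lt_compat; Lra.lra.
have : INR j * INR j <= / 4000 * INR n / Rpower.ln (INR n).
  rewrite -(sqrt_sqrt _ x0); exact: Rmult_le_compat.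
move=> /(Rmult_le_compat_r (Rpower.ln (INR n)) _ _ (Rlt_le _ _ (Rlt_trans _ _ _ (Rinv_0_lt_compat _ Rlt_0_2) half))).
rewrite /Rdiv (Rmult_assoc _ (Rinv _)) Rinv_l; last Lra.lra.
move=> H.
have : INR j * INR j * INR (up_log 2 n) <= INR j * INR j * (4 * Rpower.ln (INR n)).
  by apply: Rmult_le_compat_l => //; exact: Rmult_le_pos.
Lra.lra.
Qed.

Lemma prob_low_levels_filled_ge eps : 0 < eps ->
  exists N : nat, forall n : nat, (N <= n)%N ->
    1 - eps <= prob_low_levels_filled n (k0_of (/ 4000) n).
Proof.
move=> eps0; have [N HN] := INR_unbounded (3 / eps).
(* The failure probability 3/n is at most [eps] once [n] exceeds [3 / eps]; the 2 makes ln n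
   positive. *)
exists (maxn N 2) => n; rewrite geq_max => /andP[Nn n1].
set good := [set w : sample_space n | low_levels_filled (k0_of (/ 4000) n) w].
suff Hbad : (#|~: good| * n <= 3 * #|[set: sample_space n]|)%N.
  have O0 : (0 < INR #|[set: sample_space n]|).
    apply: lt_0_INR; apply/ssrnat.ltP; rewrite card_gt0; apply/set0Pn.
    by exists [ffun=> 1%g]; rewrite inE.
  have n3 : (3 / eps < INR n) by apply: Rlt_le_trans HN _; apply/INR_leq.
  have cn : (0 < INR n) by apply: lt_0_INR; apply/ssrnat.ltP; exact: ltnW.
  have e3 : (3 <= eps * INR n).
    apply: Rlt_le; move/(Rmult_lt_compat_l _ _ _ eps0): n3.
    by rewrite /Rdiv Rmult_comm Rmult_assoc Rinv_l ?Rmult_1_r //; Lra.lra.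
  rewrite /prob_low_levels_filled -/good.
  have := cardsC good; rewrite -cardsT => /(congr1 INR); rewrite INR_addn => E.
  move/INR_leq: Hbad; rewrite !INR_muln.
  have -> : INR 3 = 3 by rewrite INR_IZR_INZ.
  move: E O0.
  set o := INR #|[set: sample_space n]|; set g := INR #|good|; set b := INR #|~: good|.
  move=> E O0 H.
  apply: (Rmult_le_reg_r o) => //; rewrite /Rdiv Rmult_assoc Rinv_l ?Rmult_1_r; last by Lra.lra.
  suff : (b <= eps * o) by Lra.lra.
  apply: (Rmult_le_reg_r (INR n)) => //; apply: Rle_trans H _.
  have := Rmult_le_compat_r o _ _ (Rlt_le _ _ O0) e3; Lra.lra.
(* The cap [j <= n] guarantees a largest such [j] and excludes no cardinality of a vertex. *)
pose P j := Rle_bool (INR j) (k0_of (/ 4000) n) && (j <= n)%N.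
have P0 : exists j, P j.
  by exists 0%N; rewrite /P /Rle_bool andbT; case: Rle_dec => //; case; exact: sqrt_pos.
have Pb j : P j -> (j <= n)%N by case/andP.
case: (ex_maxnP P0 Pb) => k /andP[kk0 _] kmax.
have small (x : {set 'I_n}) : Rle_bool (INR #|x|) (k0_of (/ 4000) n) -> (#|x| <= k)%N.
  by move=> xk; apply: kmax; rewrite /P xk card_leqn.
(* For [k = 0] only level 0 is concerned, and it is occupied from the start. *)
have [k0|k_gt0] := posnP k.
  rewrite (_ : ~: good = set0) ?cards0 ?mul0n //; apply/setP => w; rewrite !inE.
  apply/negbTE; rewrite negbK; apply/forallP => x; apply/implyP => /small.
  by rewrite k0 leqn0 cards_eq0 => /eqP ->; exact: set0_in_cluster.
have l_gt0 : (0 < up_log 2 n)%N by rewrite up_log_gt0.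
have kln : (1000 * (k * k * up_log 2 n) <= n)%N.
  by apply: k0_bound => //; move: kk0; rewrite /Rle_bool; case: Rle_dec.
have nl : (n <= 2 ^ up_log 2 n)%N by exact: up_logP.
apply: leq_trans _ (card_not_low_filled R k_gt0 l_gt0 kln nl).
rewrite leq_mul2r; apply/orP; right; apply: subset_leq_card; apply/subsetP => w.
rewrite !inE; apply: contra => /forallP H; apply/forallP => x; apply/implyP => /small xk.
by move: (H x); rewrite xk.
Qed.

End RealBounds.

Theorem theorem1 :
  exists c0 : R, Rlt 0 c0 /\
    forall eps : R, Rlt 0 eps ->
      exists N : nat, forall n : nat, (N <= n)%N ->
        Rle (Rminus 1 eps) (prob_low_levels_filled n (k0_of c0 n)).
Proof.
exists (Rinv 4000); split; first by Lra.lra.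
exact: prob_low_levels_filled_ge.
Qed.
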